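(* Let $(G,f,h)$ be a finite-state time-weighted automaton over $\Sigma$, let $E\subseteq\Sigma^*$, and let $\mathcal{E}_T=\{(E_i,d_i)\mid i\in I\}$ be a finite set of job requirements with deadlines such that $\Sigma=\bigcup_{i\in I}\Sigma_i$. Let $H$ be the language obtained by the pruned tree construction described in the context, and let $K_*$ be the supremal sublanguage of $H$ that is controllable with respect to $G$. Then $K_*=\sup\mathcal{C}(G,f,h,E,\mathcal{E}_T)$.
   Context: **Time-weighted automaton.** $G=(X,\Sigma,\xi,x_0,X_m)$ is a deterministic finite automaton with partial transition function $\xi$. $L(G)=\{s\in\Sigma^*\mid \xi(x_0,s)\text{ is defined}\}$ is its closed behavior and $L_m(G)=\{s\in L(G)\mid \xi(x_0,s)\in X_m\}$ its marked behavior. $\mathcal{T}=\{(x,\sigma)\in X\times\Sigma\mid \xi(x,\sigma)\text{ is defined}\}$ is the set of transitions. $f:\mathcal{T}\to\mathbb{R}^+$ (positive reals) gives the duration of each transition. $h\subseteq\Sigma\times\Sigma$ is a reflexive and symmetric mutual exclusion relation. The triple $(G,f,h)$ is a finite-state time-weighted automaton. The alphabet is a disjoint union $\Sigma=\Sigma_c\,\dot\cup\,\Sigma_{uc}$ of controllable and uncontrollable events. **Execution time.** The relation $h$ induces a finite nonempty resource set $\mathcal{R}$ and a map $R:\mathcal{T}\to 2^{\mathcal{R}}$, where $R(x,\sigma)$ depends only on $\sigma$ and $R(x,\sigma)\cap R(x',\sigma')\neq\varnothing$ iff $(\sigma,\sigma')\in h$. Put $n_h=|\mathcal{R}|$. For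 $\tau\in\mathcal{T}$, $\hat{\mathcal{M}}_{G,f,h}(\tau)$ is the $n_h\times n_h$ matrix over the max-plus semiring $\mathbb{R}_{max}=\mathbb{R}\cup\{-\infty\}$ whose $(q,v)$ entry is $0$ if ($q=v$ and $q\notin R(\tau)$) or ($q\in R(\tau)$ and $v\notin R(\tau)$); is $f(\tau)$ if $q,v\in R(\tau)$; and is $-\infty$ otherwise. Extend $\hat{\mathcal{M}}_{G,f,h}$ to a morphism on $\mathcal{T}^*$ by max-plus matrix multiplication, with $\epsilon$ mapped to the max-plus identity ($0$ on the diagonal, $-\infty$ elsewhere). For $s\in L(G)$ let $\varpi(s)\in\mathcal{T}^*$ be the sequence of transitions executed by $s$ from $x_0$. The execution time of $s$ is $\upsilon_f(s)=\mathbf{1}^t\hat{\mathcal{M}}_{G,f,h}(\varpi(s))\mathbf{1}$, computed in max-plus algebra with $\mathbf{1}$ the all-zero column vector; that is, the maximum entry of $\hat{\mathcal{M}}_{G,f,h}(\varpi(s))$. **Jobs.** $I$ is a finite index set. For $i\in I$: $\Sigma_i\subseteq\Sigma$, $E_i\subseteq\Sigma_i^*$ is a regular language, $d_i\in\mathbb{R}^+$ is its deadline, and $P_i:\Sigma^*\to\Sigma_i^*$ is the natural projection (erasing events not in $\Sigma_i$). For $s\in L(G)$, the job $E_i$ execution time is $t_{E_i,f}(s)=\min\{\upsilon_f(s')\mid s'\text{ a prefix of }s,\ P_i(s')=P_i(s)\}$, i.e. the execution time of the prefix of $s$ ending at the last event of $s$ in $\Sigma_i$ (and $0$ if there is no such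 event). $W_f(\mathcal{E}_T)$ is the set of strings $s$ with $P_i(s)\in E_i$ and $t_{E_i,f}(s)\le d_i$ for all $i\in I$ (only its intersection with $L_m(G)$ is used). $\|_{i\in I}E_i=\{s\in\Sigma^*\mid \forall i\in I,\ P_i(s)\in E_i\}$. **Controllability.** $K\subseteq L_m(G)$ is controllable w.r.t. $G$ if $\overline{K}\Sigma_{uc}\cap L(G)\subseteq\overline{K}$, where $\overline{K}$ is the prefix closure. $\mathcal{C}(G,f,h,E,\mathcal{E}_T)$ is the collection of all $K\subseteq L_m(G)\cap E\cap W_f(\mathcal{E}_T)$ that are controllable w.r.t. $G$. It has a unique largest element under inclusion, denoted $\sup\mathcal{C}(G,f,h,E,\mathcal{E}_T)$. **Pruned tree construction of $H$.** Let $L_0=L_m(G)\cap E\cap\|_{i\in I}E_i$ and take the tree-structured automaton of $L_0$: its states are the strings $s\in\overline{L_0}$, with root $\epsilon$ and an edge $s\xrightarrow{\sigma}s\sigma$ whenever $s\sigma\in\overline{L_0}$; the marked states are the $s\in L_0$. Each state $s$ carries the matrix $\hat{\mathcal{M}}_{G,f,h}(\varpi(s))$, the time $\upsilon_f(s)$, and numbers $t_i(s)$, $i\in I$, defined by $t_i(\epsilon)=0$ and, along an edge $s\to s\sigma$, $t_i(s\sigma)=\upsilon_f(s\sigma)$ if $\sigma\in\Sigma_i$ and $t_i(s\sigma)=t_i(s)$ otherwise; the matrix is updated by right multiplication by the matrix of the new transition. Whenever a state $s$ has $t_i(s)>d_i$ for some $i\in I$, the whole subtree rooted at $s$ (including $s$)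 is cut. $H$ is the set of marked states that remain. *)

(* Defs.v *)
From HB Require Import structures.
From mathcomp Require Import all_boot all_order all_algebra.
From mathcomp Require Import mathcomp_extra boolp classical_sets reals.

Set Implicit Arguments.
Unset Strict Implicit.
Unset Printing Implicit Defensive.

Import Order.TTheory GRing.Theory Num.Theory.
Local Open Scope classical_set_scope.
Local Open Scope ring_scope.

(* The max-plus semiring: [None] is minus infinity. In the semiring structure
   declared below the generic [0] is minus infinity, the generic [1] is the
   real number 0, [+] is the maximum and [*] is the addition of reals. *)
Definition maxplus (R : realType) : Type := option R.

Definition fin (R : realType) (x : R) : maxplus R := Some x.
Definition ninf (R : realType) : maxplus R := None.
Arguments ninf {R}.

Section MaxPlus.
Variable R : realType.
Implicit Types x y z : maxplus R.

HB.instance Definition _ := Choice.copy (maxplus R) (option R).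

Definition mp_le x y : bool :=
  match x, y with
  | None, _ => true
  | Some _, None => false
  | Some a, Some b => a <= b
  end.

Fact mp_le_refl : reflexive mp_le. Proof. by case=> [a|] //=. Qed.

Fact mp_le_anti : antisymmetric mp_le.
Proof. by case=> [a|] [b|] //= /le_anti ->. Qed.

Fact mp_le_trans : transitive mp_le.
Proof. by case=> [b|] [a|] [c|] //=; apply: le_trans. Qed.

Fact mp_le_total : total mp_le.
Proof. by case=> [a|] [b|] //=; apply: le_total. Qed.

HB.instance Definition _ := Order.Le_isPOrder.Build Order.default_display
  (maxplus R) mp_le_refl mp_le_anti mp_le_trans.
HB.instance Definition _ :=
  Order.POrder_isTotal.Build Order.default_display (maxplus R) mp_le_total.

Definition mp_add x y : maxplus R := Order.max x y.

Definition mp_mul x y : maxplus R :=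
  match x, y with
  | Some a, Some b => fin (a + b)
  | _, _ => ninf
  end.

Fact mp_addA : associative mp_add. Proof. exact: maxA. Qed.
Fact mp_addC : commutative mp_add. Proof. exact: maxC. Qed.
Fact mp_add0 : left_id ninf mp_add.
Proof. by move=> x; rewrite /mp_add max_r. Qed.

HB.instance Definition _ :=
  GRing.isNmodule.Build (maxplus R) mp_addA mp_addC mp_add0.

Fact mp_mulA : associative mp_mul.
Proof. by case=> [a|] [b|] [c|] //=; rewrite /fin addrA. Qed.
Fact mp_mulC : commutative mp_mul.
Proof. by case=> [a|] [b|] //=; rewrite /fin addrC. Qed.
Fact mp_mul1 : left_id (fin 0) mp_mul.
Proof. by case=> [a|] //=; rewrite /fin add0r. Qed.
Fact mp_mulDl : left_distributive mp_mul +%R.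
Proof.
have le_mul z : {homo mp_mul^~ z : x y / (x <= y)%O}.
  case: z => [c|] [a|] [b|] //; rewrite /Order.le /= => ab.
  by rewrite lerD2r.
move=> x y z; rewrite /GRing.add /= /mp_add.
by case: (leP x y) => [|/ltW] /(le_mul z) h;
  [rewrite (max_r h)|rewrite (max_l h)].
Qed.
Fact mp_mul0 : left_zero ninf mp_mul. Proof. by []. Qed.
Fact mp_1neq0 : fin 0 != ninf. Proof. by []. Qed.

HB.instance Definition _ := GRing.Nmodule_isComNzSemiRing.Build (maxplus R)
  mp_mulA mp_mulC mp_mul1 mp_mulDl mp_mul0 mp_1neq0.

End MaxPlus.

Definition language (Sigma : finType) := set (seq Sigma).

Section Languages.
Variable Sigma : finType.
Implicit Types (s : seq Sigma) (K L : language Sigma) (A : {set Sigma}).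

Definition closure L : language Sigma :=
  [set s | exists2 s', L s' & prefix s s'].

Definition proj A s : seq Sigma := [seq a <- s | a \in A].

End Languages.

Record automaton (Sigma : finType) := Automaton {
  state : finType;
  delta : state -> Sigma -> option state;
  init : state;
  marked : {set state}
}.

Section Automata.
Variables (Sigma : finType) (G : automaton Sigma).

Fixpoint run (x : state G) (s : seq Sigma) : option (state G) :=
  if s is a :: s' then
    if delta x a is Some y then run y s' else None
  else Some x.

Definition closed_behavior : language Sigma :=
  [set s | run (init G) s].

Definition marked_behavior : language Sigma :=
  [set s | exists2 x, run (init G) s = Some x & x \in marked G].

Definition transition :=
  {p : state G * Sigma | isSome (delta p.1 p.2)}.

Definition event (t : transition) : Sigma := (val t).2.

Fixpoint transitions_from (x : state G) (s : seq Sigma) : seq transition :=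
  if s is a :: s' then
    match insub (x, a) : option transition, delta x a with
    | Some t, Some y => t :: transitions_from y s'
    | _, _ => [::]
    end
  else [::].

(* Only meaningful on the closed behavior: outside it, the sequence stops at
   the first undefined transition. *)
Definition transitions (s : seq Sigma) : seq transition :=
  transitions_from (init G) s.

End Automata.

Definition regular (Sigma : finType) (L : language Sigma) : Prop :=
  exists A : automaton Sigma, L = marked_behavior A.

Record tw_automaton (R : realType) (Sigma : finType) := TwAutomaton {
  plant :> automaton Sigma;
  duration : transition plant -> R;
  duration_gt0 : forall t, 0 < duration t;
  mutex : rel Sigma;
  mutex_refl : reflexive mutex;
  mutex_sym : symmetric mutex
}.

(* A resource assignment induced by the mutual exclusion relation: any finite
   nonempty set of resources such that two transitions share a resource exactly
   when their events are mutually exclusive. *)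
Record resources (R : realType) (Sigma : finType)
    (G : tw_automaton R Sigma) := Resources {
  resource :> finType;
  resource_gt0 : (0 < #|resource|)%N;
  uses : transition G -> {set resource};
  uses_event : forall t t', event t = event t' -> uses t = uses t';
  usesP : forall t t',
    (uses t :&: uses t' != finset.set0)%SET = mutex G (event t) (event t')
}.

Section ExecutionTime.
Variables (R : realType) (Sigma : finType).
Variables (G : tw_automaton R Sigma) (Rs : resources G).

Definition transition_mx (t : transition G) : 'M[maxplus R]_#|Rs| :=
  \matrix_(i, j)
    let q := enum_val i in let v := enum_val j in
    if ((q == v) && (q \notin uses Rs t))
       || ((q \in uses Rs t) && (v \notin uses Rs t)) then fin 0
    else if (q \in uses Rs t) && (v \in uses Rs t) then fin (duration t)
    else ninf.

Definition exec_mx (w : seq (transition G)) : 'M[maxplus R]_#|Rs| :=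
  \prod_(t <- w) transition_mx t.

Lemma exec_mx_rcons w t : exec_mx (rcons w t) = exec_mx w *m transition_mx t.
Proof. by rewrite /exec_mx big_rcons. Qed.

Definition exec_time (s : seq Sigma) : maxplus R :=
  let one : 'cV[maxplus R]_#|Rs| := const_mx (fin 0) in
  (one^T *m exec_mx (transitions G s) *m one) ord0 ord0.

End ExecutionTime.

Record job (R : realType) (Sigma : finType) := Job {
  job_events : {set Sigma};
  job_lang : language Sigma;
  job_lang_events : forall s, job_lang s -> {subset s <= job_events};
  job_lang_regular : regular job_lang;
  deadline : R;
  deadline_gt0 : 0 < deadline
}.

Section Requirements.
Variables (R : realType) (Sigma : finType).
Variables (G : tw_automaton R Sigma) (Rs : resources G).
Variables (I : finType) (J : I -> job R Sigma).

Definition jobs_lang : language Sigma :=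
  [set s | forall i, job_lang (J i) (proj (job_events (J i)) s)].

(* The minimum ranges over the prefixes [take k s] of [s]; the default value
   [exec_time Rs s] is itself one of the values being minimized. *)
Definition job_time (i : I) (s : seq Sigma) : maxplus R :=
  \big[Order.min/exec_time Rs s]_(k < (size s).+1 |
      proj (job_events (J i)) (take k s) == proj (job_events (J i)) s)
    exec_time Rs (take k s).

Definition timed_lang : language Sigma :=
  [set s | forall i, job_lang (J i) (proj (job_events (J i)) s)
                     /\ (job_time i s <= fin (deadline (J i)))%O].

End Requirements.

Section Control.
Variables (R : realType) (Sigma : finType) (Sigma_uc : {set Sigma}).

Definition controllable (G : automaton Sigma) (K : language Sigma) : Prop :=
  [set rcons s a | s in closure K & a in [set` Sigma_uc]]
    `&` closed_behavior G `<=` closure K.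

Definition controllable_sublangs (G : automaton Sigma) (L : language Sigma) :
    set (language Sigma) :=
  [set K | [/\ K `<=` marked_behavior G, K `<=` L & controllable G K]].

Definition timed_controllables (G : tw_automaton R Sigma) (Rs : resources G)
    (E : language Sigma) (I : finType) (J : I -> job R Sigma) :
    set (language Sigma) :=
  [set K | K `<=` marked_behavior G `&` E `&` timed_lang Rs J
           /\ controllable G K].

Definition is_largest (C : set (language Sigma)) (K : language Sigma) : Prop :=
  C K /\ forall K', C K' -> K' `<=` K.

(* The largest element of a class of languages; a dummy value if there is none,
   which [sup_controllable_sublangsP] and [sup_timed_controllablesP] exclude
   for the classes of interest. *)
Definition sup_lang (C : set (language Sigma)) : language Sigma :=
  xget set0 [set K | is_largest C K].

Lemma sup_langP (C : set (language Sigma)) :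
  C (\bigcup_(K in C) K) -> is_largest C (sup_lang C).
Proof.
move=> CU; apply: (@xgetPex _ set0 [set K | is_largest C K]).
by exists (\bigcup_(K in C) K); split=> // K CK s Ks; exists K.
Qed.

Lemma controllable_bigcup (G : automaton Sigma) (C : set (language Sigma)) :
  (forall K, C K -> controllable G K) -> controllable G (\bigcup_(K in C) K).
Proof.
move=> Cc _ [[s [s' [K CK Ks'] ss'] [a au <-]] sG].
have [|t Kt ?] := Cc _ CK (rcons s a).
  by split=> //; exists s; [exists s'|exists a].
by exists t => //; exists K.
Qed.

Lemma sup_controllable_sublangsP (G : automaton Sigma) (L : language Sigma) :
  is_largest (controllable_sublangs G L) (sup_lang (controllable_sublangs G L)).
Proof.
apply: sup_langP; split; last by apply: controllable_bigcup => K [].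
- by move=> s [K [KG _ _] /KG].
- by move=> s [K [_ KL _] /KL].
Qed.

Lemma sup_timed_controllablesP (G : tw_automaton R Sigma) (Rs : resources G)
    (E : language Sigma) (I : finType) (J : I -> job R Sigma) :
  is_largest (timed_controllables Rs E J)
    (sup_lang (timed_controllables Rs E J)).
Proof.
apply: sup_langP; split; last by apply: controllable_bigcup => K [].
by move=> s [K [KL _] /KL].
Qed.

End Control.

Section PrunedTree.
Variables (R : realType) (Sigma : finType).
Variables (G : tw_automaton R Sigma) (Rs : resources G).
Variables (E : language Sigma) (I : finType) (J : I -> job R Sigma).

Definition untimed_lang : language Sigma :=
  marked_behavior G `&` E `&` jobs_lang J.

Definition tree_state : language Sigma := closure untimed_lang.

(* Following the edges labelled by [s] from the tree state [r], at which the
   clock has value [t]. *)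
Fixpoint clock_from (i : I) (r : seq Sigma) (t : maxplus R) (s : seq Sigma) :
    maxplus R :=
  if s is a :: s' then
    clock_from i (rcons r a)
      (if a \in job_events (J i) then exec_time Rs (rcons r a) else t) s'
  else t.

Definition clock (i : I) (s : seq Sigma) : maxplus R :=
  clock_from i [::] (fin 0) s.

Lemma clock_nil i : clock i [::] = fin 0. Proof. by []. Qed.

Lemma clock_rcons i s a :
  clock i (rcons s a) =
    if a \in job_events (J i) then exec_time Rs (rcons s a) else clock i s.
Proof.
suff H r t : clock_from i r t (rcons s a) =
    if a \in job_events (J i) then exec_time Rs (r ++ rcons s a)
    else clock_from i r t s by exact: H.
elim: s r t => [|b s IHs] r t /=; first by rewrite cats1.
by rewrite IHs cat_rcons.
Qed.

Definition late (r : seq Sigma) : Prop :=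
  exists i, (fin (deadline (J i)) < clock i r)%O.

Definition cut : language Sigma :=
  [set s | exists r, [/\ tree_state r, late r & prefix r s]].

Definition pruned_lang : language Sigma :=
  [set s | [/\ tree_state s, untimed_lang s & ~ cut s]].

End PrunedTree.

(* Main.v *)
(* Every transition matrix dominates the max-plus identity matrix, so the
   execution time is nondecreasing along prefixes. Hence the clock [t_i] of a
   tree state is the job execution time of that string and is itself
   nondecreasing along prefixes: a marked state survives the pruning exactly
   when it meets all deadlines itself, and the two suprema are taken over the
   same class of languages. *)
Require Import Defs.
From mathcomp Require Import all_boot all_order all_algebra.
From mathcomp Require Import mathcomp_extra boolp classical_sets reals.

Set Implicit Arguments.
Unset Strict Implicit.
Unset Printing Implicit Defensive.

Local Open Scope classical_set_scope.
Local Open Scope ring_scope.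

Import Order.TTheory GRing.Theory Num.Theory.

Section ExecTime.
Variables (R : realType) (Sigma : finType).
Variables (G : tw_automaton R Sigma) (Rs : resources G).

(** Addition is the maximum, so inequalities become equations open to matrix algebra. *)
Lemma maxplus_leE (x y : maxplus R) : (x <= y)%O = (x + y == y).
Proof. by rewrite eq_joinr. Qed.

(** Off the diagonal the identity is minus infinity; on it, a transition matrix has 0 or a positive
    duration. *)
Lemma transition_mx_add1 (t : transition G) :
  1%:M + transition_mx Rs t = transition_mx Rs t.
Proof.
apply/matrixP => i j; rewrite !mxE.
have [->|_] := eqVneq i j; last first.
  by rewrite add0r.
rewrite mulr1n /= eqxx; apply/eqP; rewrite -maxplus_leE.
case: (enum_val j \in _) => /=; last exact: (lexx (0 : R)).
exact: (ltW (duration_gt0 t)).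
Qed.

(** The first case covers an undefined run on [rcons s a], so that monotonicity holds for all
    strings. *)
Lemma transitions_from_rcons (x : state G) s a :
  transitions_from x (rcons s a) = transitions_from x s
  \/ exists t, transitions_from x (rcons s a) = rcons (transitions_from x s) t.
Proof.
elim: s x => [|b s IHs] x /=; case: insubP => [t _ _|_]; try by left.
  by case: (delta x a) => [y|]; [right; exists t|left].
case: (delta x b) => [y|]; last by left.
by case: (IHs y) => [->|[t' ->]]; [left|right; exists t'].
Qed.

Lemma exec_time_rcons_le s a :
  (exec_time Rs s <= exec_time Rs (rcons s a))%O.
Proof.
rewrite /exec_time /transitions.
case: (transitions_from_rcons (init G) s a) => [->|[t ->]]; first exact: lexx.
rewrite exec_mx_rcons maxplus_leE; apply/eqP.
set u := const_mx _; set A := exec_mx _ _; set B := _ *m u; set C := _ *m u.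
(* [B + C] factors as [u^T *m (A *m (1 + M)) *m u], with [M] the new transition matrix, and
   [1 + M = M]. *)
suff BC : B + C = C by move/matrixP/(_ ord0 ord0): BC; rewrite [LHS]mxE.
rewrite /B /C -mulmxDl -mulmxDr -[X in X + A *m _]mulmx1 -mulmxDr.
by rewrite transition_mx_add1.
Qed.

Lemma exec_time_nil : exec_time Rs [::] = fin 0.
Proof.
rewrite /exec_time /transitions /= /exec_mx big_nil mulmx1 mxE.
rewrite (eq_bigr (fun=> fin 0)) => [|i _]; last by rewrite !mxE /fin mul1r.
(* Nonemptiness of [Rs] matters: an empty sum would be minus infinity. *)
rewrite big_const card_ord; case: #|Rs| (resource_gt0 Rs) => // n _.
elim: n => [|n IHn]; first by rewrite /= addr0.
by rewrite iterS IHn; apply: maxxx.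
Qed.

End ExecTime.

Section Clocks.
Variables (R : realType) (Sigma : finType).
Variables (G : tw_automaton R Sigma) (Rs : resources G).
Variables (I : finType) (J : I -> job R Sigma).

Lemma clock_le_exec_time i s : (clock Rs J i s <= exec_time Rs s)%O.
Proof.
elim/last_ind: s => [|s a IHs]; first by rewrite clock_nil exec_time_nil.
rewrite clock_rcons; case: ifP => // _.
exact: le_trans IHs (exec_time_rcons_le _ _ _).
Qed.

(** The clock changes only by jumping to the current execution time, which bounds all earlier clock
    values. *)
Lemma clock_cat_le i s t : (clock Rs J i s <= clock Rs J i (s ++ t))%O.
Proof.
elim/last_ind: t => [|t a IHt]; first by rewrite cats0.
rewrite -rcons_cat clock_rcons; case: ifP => // _; apply: (le_trans IHt).
exact: le_trans (clock_le_exec_time _ _) (exec_time_rcons_le _ _ _).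
Qed.

Lemma clock_cat_proj i s t :
  Defs.proj (job_events (J i)) (s ++ t) = Defs.proj (job_events (J i)) s ->
  clock Rs J i (s ++ t) = clock Rs J i s.
Proof.
rewrite /Defs.proj filter_cat => /(congr1 size); rewrite size_cat => /eqP.
(* Cancelling lengths leaves no job event in [t]. *)
rewrite -[X in _ == X]addn0 eqn_add2l size_eq0.
elim/last_ind: t => [|t a IHt]; first by rewrite cats0.
rewrite filter_rcons -rcons_cat clock_rcons; case: ifP => [_|_ /IHt //].
by case: filter.
Qed.

(** The prefix ends at the last job event, or is empty if there is none; it attains the minimum in
    [job_time]. *)
Lemma clock_witness i s :
  exists k, [/\ (k <= size s)%N,
    Defs.proj (job_events (J i)) (take k s) = Defs.proj (job_events (J i)) s
    & clock Rs J i s = exec_time Rs (take k s)].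
Proof.
elim/last_ind: s => [|s a [k [ks ps cs]]].
  by exists 0; rewrite clock_nil exec_time_nil.
rewrite clock_rcons size_rcons; case: ifP => [_|aJ].
  by exists (size s).+1; rewrite take_oversize ?size_rcons.
exists k; split; first exact: leqW.
- by rewrite -cats1 takel_cat // ps /Defs.proj filter_cat /= aJ cats0.
- by rewrite -cats1 takel_cat.
Qed.

Lemma job_timeE i s : job_time Rs J i s = clock Rs J i s.
Proof.
apply/le_anti/andP; split.
  have [k [ks /eqP ps ->]] := clock_witness i s.
  exact: (bigmin_le_cond _ _ (j := Ordinal (ks : (k < (size s).+1)%N))).
(* The default value of the minimum needs the bound too; every other candidate prefix has the same
   clock as [s]. *)
apply/bigmin_geP; split => [|k /eqP ps]; first exact: clock_le_exec_time.
rewrite -{1}(cat_take_drop k s) clock_cat_proj ?cat_take_drop //.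
exact: clock_le_exec_time.
Qed.

Lemma pruned_langE (E : language Sigma) :
  pruned_lang Rs E J = marked_behavior G `&` E `&` timed_lang Rs J.
Proof.
apply/seteqP; split => s.
  move=> [sT [[sG sE] sJ] Ncut]; split=> // i; split; first exact: sJ.
  rewrite job_timeE leNgt; apply/negP => lt_ds; apply: Ncut.
  by exists s; split=> //; [exists i|exact: prefix_refl].
move=> [[sG sE] sJ]; have sL : untimed_lang G E J s.
  by split=> // i; have [] := sJ i.
split=> //; first by exists s => //; exact: prefix_refl.
(* A deadline missed at the ancestor [r] stays missed at [s]. *)
case=> r [_ [i lt_dr] /prefixP[t s_rt]]; have [_] := sJ i.
by rewrite job_timeE leNgt s_rt (lt_le_trans lt_dr (clock_cat_le _ _ _)).
Qed.

End Clocks.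

Theorem theorem1 (R : realType) (Sigma : finType)
    (Sigma_c Sigma_uc : {set Sigma})
    (Sigma_U : (Sigma_c :|: Sigma_uc)%SET = finset.setT)
    (Sigma_I : (Sigma_c :&: Sigma_uc)%SET = finset.set0)
    (G : tw_automaton R Sigma) (Rs : resources G) (E : language Sigma)
    (I : finType) (J : I -> job R Sigma)
    (J_cover : (\bigcup_(i : I) job_events (J i))%SET = finset.setT) :
  sup_lang (controllable_sublangs Sigma_uc G (pruned_lang Rs E J))
  = sup_lang (timed_controllables Sigma_uc Rs E J).
Proof.
congr sup_lang; rewrite pruned_langE; apply/seteqP; split => K.
  by move=> [_ KL Kc].
by move=> [KL Kc]; split=> // s /KL [[]].
Qed.
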